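(* There exist absolute constants $c,d>0$ such that the following holds for every finite-precision Lanczos run of $k$ completed iterations (for arbitrary $n$, symmetric $A\in\mathbb{R}^{n\times n}$, nonzero $v\in\mathbb{R}^n$, $k_{\max}$, $k\le k_{\max}$ and $0\le\varepsilon\le 1/(20k_{\max})$, as defined in the context). For $1\le j\le k$ put $$f_j:=Av_j-\beta_{j-1}v_{j-1}-\alpha_jv_j-\beta_jv_{j+1},\qquad g_j:=v_j^{\mathsf T}v_j-1,\qquad p_j:=v_j^{\mathsf T}(\beta_jv_{j+1}).$$ Then for all $1\le j\le k$, $$\|f_j\|\le c\,k^d\,\varepsilon\|A\|,\qquad |g_j|\le\varepsilon,\qquad |p_j|\le c\,k^d\,\varepsilon\|A\|.$$
   Context: Norms are Euclidean for vectors and spectral for matrices; $e_j$ denotes a standard basis vector. Finite-precision Lanczos run. Let $n,k_{\max}\ge1$ be integers, $A\in\mathbb{R}^{n\times n}$ symmetric, $v\in\mathbb{R}^n$ nonzero, and let the accuracy parameter satisfy $0\le\varepsilon\le 1/(20k_{\max})$. A run of $k$ completed iterations ($1\le k\le k_{\max}$) of the finite-precision symmetric Lanczos algorithm without reorthogonalization on $(A,v)$ consists of real vectors $v_j,u_j,w_j,z_j\in\mathbb{R}^n$ and real scalars $\alpha_j,\beta_j$ such that: $v_0=0$, $\beta_0=0$; $v_1$ satisfies $|v_1^{\mathsf T}v_1-1|\le\varepsilon$ and $\beta v_1=v+\Delta_0$ for some $\beta>0$ and some $\Delta_0$ with $\|\Delta_0\|\le\varepsilon\|v\|$; and for $j=1,\dots,k$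 there are errors with $$u_j=Av_j+e^u_j,\quad \|e^u_j\|\le\varepsilon\|A\|\|v_j\|;$$ $$w_j=u_j-\beta_{j-1}v_{j-1}+e^w_j,\quad \|e^w_j\|\le\varepsilon(\|u_j\|+\beta_{j-1}\|v_{j-1}\|);$$ $$\alpha_j=v_j^{\mathsf T}w_j+e^\alpha_j,\quad |e^\alpha_j|\le\varepsilon\|v_j\|\|w_j\|;$$ $$z_j=w_j-\alpha_jv_j+e^z_j,\quad \|e^z_j\|\le\varepsilon(\|w_j\|+|\alpha_j|\|v_j\|).$$ If $z_j\ne0$ then $\beta_j>0$, $\beta_jv_{j+1}=z_j+\Delta_j$ with $\|\Delta_j\|\le\varepsilon\|z_j\|$, and $|v_{j+1}^{\mathsf T}v_{j+1}-1|\le\varepsilon$. If $z_j=0$ then $\beta_j=0$ and the algorithm terminates. Termination can occur only at $j=k$, so $\beta_1,\dots,\beta_{k-1}>0$. If the run terminates at step $k$, $v_{k+1}$ is not formed and by convention $\Delta_k=0$ and $\beta_kv_{k+1}=0$. *)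

(* Defs.v *)
From mathcomp Require Import all_boot all_order all_algebra.
From mathcomp Require Import all_classical all_reals all_analysis.

Set Implicit Arguments.
Unset Strict Implicit.
Unset Printing Implicit Defensive.

Import Order.TTheory GRing.Theory Num.Theory.

Local Open Scope classical_set_scope.
Local Open Scope ring_scope.

Definition dot (R : realType) (n : nat) (x y : 'cV[R]_n) : R :=
  (x^T *m y) 0 0.

(* The library norm [`|x|] on matrices is the maximum of the absolute values of
   the entries, hence the definitions of the Euclidean and spectral norms. *)
Definition enorm (R : realType) (n : nat) (x : 'cV[R]_n) : R :=
  Num.sqrt (dot x x).

Definition spectral_norm (R : realType) (m n : nat) (A : 'M[R]_(m, n)) : R :=
  sup [set enorm (A *m x) | x in [set x : 'cV[R]_n | enorm x <= 1]].

(* [v j], [beta j] are indexed from 0, the other sequences from 1; all values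
   not mentioned below (such as [v k.+1] when [z k = 0]) are irrelevant. *)
Record lanczos_data (R : realType) (n : nat) := LanczosData {
  lv : nat -> 'cV[R]_n;
  lu : nat -> 'cV[R]_n;
  lw : nat -> 'cV[R]_n;
  lz : nat -> 'cV[R]_n;
  lalpha : nat -> R;
  lbeta : nat -> R }.

Definition lanczos_init (R : realType) (n : nat) (v : 'cV[R]_n) (eps : R)
    (L : lanczos_data R n) : Prop :=
  [/\ lv L 0%N = 0,
      lbeta L 0%N = 0,
      `|dot (lv L 1%N) (lv L 1%N) - 1| <= eps &
      exists (b : R) (Delta : 'cV[R]_n),
        [/\ 0 < b, enorm Delta <= eps * enorm v & b *: lv L 1%N = v + Delta]].

(* For [j > 0]; [j.-1] is then the true predecessor. *)
Definition lanczos_step (R : realType) (n : nat) (A : 'M[R]_n) (eps : R)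
    (L : lanczos_data R n) (j : nat) : Prop :=
  let: LanczosData v u w z alpha beta := L in
  [/\ exists2 eu : 'cV[R]_n,
        enorm eu <= eps * spectral_norm A * enorm (v j) &
        u j = A *m v j + eu,
      exists2 ew : 'cV[R]_n,
        enorm ew <= eps * (enorm (u j) + beta j.-1 * enorm (v j.-1)) &
        w j = u j - beta j.-1 *: v j.-1 + ew,
      exists2 ea : R,
        `|ea| <= eps * enorm (v j) * enorm (w j) &
        alpha j = dot (v j) (w j) + ea &
      exists2 ez : 'cV[R]_n,
        enorm ez <= eps * (enorm (w j) + `|alpha j| * enorm (v j)) &
        z j = w j - alpha j *: v j + ez].

Definition lanczos_next (R : realType) (n : nat) (eps : R)
    (L : lanczos_data R n) (j : nat) : Prop :=
  let: LanczosData v u w z alpha beta := L in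
  (z j != 0 ->
     [/\ 0 < beta j,
         exists2 Delta : 'cV[R]_n,
           enorm Delta <= eps * enorm (z j) &
           beta j *: v j.+1 = z j + Delta &
         `|dot (v j.+1) (v j.+1) - 1| <= eps]) /\
  (z j = 0 -> beta j = 0).

(* When the run terminates at step [k], i.e. [z k = 0], the convention
   [beta k *: v k.+1 = 0] holds whatever [v k.+1] is, because [beta k = 0]. *)
Definition lanczos_run (R : realType) (n : nat) (A : 'M[R]_n) (v : 'cV[R]_n)
    (eps : R) (k : nat) (L : lanczos_data R n) : Prop :=
  [/\ lanczos_init v eps L,
      forall j : nat, (1 <= j <= k)%N -> lanczos_step A eps L j,
      forall j : nat, (1 <= j <= k)%N -> lanczos_next eps L j &
      forall j : nat, (1 <= j < k)%N -> lz L j != 0].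

(* Main.v *)
(** Adding up the rounding errors of one iteration expresses [f j] as minus the
    sum of these errors, and [p j] as a sum of terms each carrying a factor
    [eps]; all of them are at most a constant times [eps] times [N + b], where
    [N] is the norm of [A] and [b] is [beta j.-1].  It remains to bound [beta j]
    by a multiple of [k N].  Removing from [w j] its component along [v j] does
    not lengthen it, up to [O(eps)], so
    [beta j <= (1 + 20 eps) (N + beta j.-1)], and [(1 + 20 eps) ^+ k <= e]
    because [20 eps k <= 1]. *)
Require Import Defs.
From mathcomp Require Import all_boot all_order all_algebra.
From mathcomp Require Import all_classical all_reals all_analysis.
From mathcomp Require Import ring lra.

Import Order.TTheory GRing.Theory Num.Theory.

Local Open Scope ring_scope.

(** * Euclidean inner product and norm *)

Section EuclideanNorm.
Context {R : realType}.

Section FixedDimension.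
Context {n : nat}.
Implicit Types (x y z : 'cV[R]_n) (a : R).

Lemma dotE x y : dot x y = \sum_i x i 0 * y i 0.
Proof. by rewrite /dot mxE; apply: eq_bigr => i _; rewrite mxE. Qed.

Lemma dotC x y : dot x y = dot y x.
Proof. by rewrite !dotE; apply: eq_bigr => i _; rewrite mulrC. Qed.

Lemma dotDr x y z : dot x (y + z) = dot x y + dot x z.
Proof. by rewrite /dot mulmxDr mxE. Qed.

Lemma dotDl x y z : dot (x + y) z = dot x z + dot y z.
Proof. by rewrite dotC dotDr !(dotC z). Qed.

Lemma dotZr a x y : dot x (a *: y) = a * dot x y.
Proof. by rewrite /dot -scalemxAr mxE. Qed.

Lemma dotZl a x y : dot (a *: x) y = a * dot x y.
Proof. by rewrite dotC dotZr dotC. Qed.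

Lemma dotNr x y : dot x (- y) = - dot x y.
Proof. by rewrite -scaleN1r dotZr mulN1r. Qed.

Lemma dotNl x y : dot (- x) y = - dot x y.
Proof. by rewrite dotC dotNr dotC. Qed.

Lemma dot_ge0 x : 0 <= dot x x.
Proof. by rewrite dotE sumr_ge0 // => i _; rewrite -expr2 sqr_ge0. Qed.

Lemma dot_eq0 x : dot x x = 0 -> x = 0.
Proof.
rewrite dotE => /psumr_eq0P x0; apply/colP => i; rewrite mxE.
by apply/eqP; rewrite -sqrf_eq0 expr2 x0 // => j _; rewrite -expr2 sqr_ge0.
Qed.

Lemma enorm_ge0 x : 0 <= enorm x.
Proof. exact: sqrtr_ge0. Qed.

Lemma sqr_enorm x : enorm x ^+ 2 = dot x x.
Proof. by rewrite sqr_sqrtr // dot_ge0. Qed.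

Lemma enorm0 : enorm (0 : 'cV[R]_n) = 0.
Proof. by rewrite /enorm /dot mulmx0 mxE sqrtr0. Qed.

Lemma enorm_eq0 x : enorm x = 0 -> x = 0.
Proof. by move=> x0; apply: dot_eq0; rewrite -sqr_enorm x0 expr0n. Qed.

Lemma enormZ a x : enorm (a *: x) = `|a| * enorm x.
Proof.
by rewrite /enorm dotZl dotZr mulrA -expr2 sqrtrM ?sqr_ge0 // sqrtr_sqr.
Qed.

Lemma enormN x : enorm (- x) = enorm x.
Proof. by rewrite -scaleN1r enormZ normrN1 mul1r. Qed.

(** Cauchy-Schwarz: the squared length of [dot y y *: x - dot x y *: y] is [dot y y] times the gap
    between the two sides. *)
Lemma sqr_dot_le x y : dot x y ^+ 2 <= dot x x * dot y y.
Proof.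
have [/dot_eq0 ->|yy0] := eqVneq (dot y y) 0.
  by rewrite -(scale0r 0) !dotZr !mul0r mulr0 expr0n.
have yy : 0 < dot y y by rewrite lt_neqAle eq_sym yy0 dot_ge0.
have := dot_ge0 (dot y y *: x - dot x y *: y).
rewrite !(dotDl, dotDr, dotNl, dotNr, dotZl, dotZr) (dotC y x).
rewrite (_ : _ + _ = dot y y * (dot x x * dot y y - dot x y ^+ 2)); last by ring.
by rewrite pmulr_rge0 // subr_ge0.
Qed.

Lemma normr_dot_le x y : `|dot x y| <= enorm x * enorm y.
Proof.
rewrite -(ler_pXn2r (n := 2)) ?nnegrE ?mulr_ge0 ?enorm_ge0 //.
by rewrite exprMn !sqr_enorm real_normK ?num_real // sqr_dot_le.
Qed.

Lemma enormD x y : enorm (x + y) <= enorm x + enorm y.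
Proof.
rewrite -(ler_pXn2r (n := 2)) ?nnegrE ?addr_ge0 ?enorm_ge0 //.
rewrite sqrrD !sqr_enorm !(dotDl, dotDr) (dotC y x).
have := le_trans (ler_norm _) (normr_dot_le x y).
lra.
Qed.

Lemma enormB x y : enorm (x - y) <= enorm x + enorm y.
Proof. by rewrite -(enormN y) enormD. Qed.

(** The squared length drops by [dot x y ^+ 2 * (2 - dot x x)], so [x] may deviate from unit length,
    as the computed Lanczos vectors do. *)
Lemma enorm_sub_proj_le x y :
  dot x x <= 2 -> enorm (y - dot x y *: x) <= enorm y.
Proof.
move=> xx2; rewrite -(ler_pXn2r (n := 2)) ?nnegrE ?enorm_ge0 // !sqr_enorm.
rewrite !(dotDl, dotDr, dotNl, dotNr, dotZl, dotZr) (dotC y x).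
have : 0 <= dot x y ^+ 2 * (2 - dot x x) by rewrite mulr_ge0 ?sqr_ge0 ?subr_ge0.
lra.
Qed.

End FixedDimension.

(** * The spectral norm as a finite supremum *)

Section SpectralNorm.
Context {m n : nat}.
Implicit Types (A : 'M[R]_(m, n)) (x : 'cV[R]_n).

(** Cauchy-Schwarz on each row; the sum is the squared Frobenius norm, which serves to make the
    supremum finite. *)
Lemma dot_mulmx_le A x :
  dot (A *m x) (A *m x) <= (\sum_i dot (row i A)^T (row i A)^T) * dot x x.
Proof.
rewrite dotE mulr_suml; apply: ler_sum => i _.
have -> : (A *m x) i 0 = dot (row i A)^T x.
  by rewrite /dot trmxK -row_mul [RHS]mxE.
by rewrite -expr2 sqr_dot_le.
Qed.

Lemma has_sup_spectral_norm A :
  has_sup [set enorm (A *m x) | x in [set x : 'cV[R]_n | enorm x <= 1]]%classic.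
Proof.
split; first by exists (enorm (A *m 0)), 0; rewrite //= enorm0.
exists (Num.sqrt (\sum_i dot (row i A)^T (row i A)^T)) => _ [x x1 <-].
have S0 : 0 <= \sum_i dot (row i A)^T (row i A)^T.
  by rewrite sumr_ge0 // => i _; exact: dot_ge0.
rewrite /enorm ler_sqrt //; apply: le_trans (dot_mulmx_le A x) _.
by rewrite ler_piMr // -sqr_enorm expr_le1 // enorm_ge0.
Qed.

Lemma spectral_norm_ge0 A : 0 <= spectral_norm A.
Proof.
apply: sup_upper_bound; first exact: has_sup_spectral_norm.
by exists 0; rewrite /= ?mulmx0 enorm0.
Qed.

Lemma enorm_mulmx_le A x : enorm (A *m x) <= spectral_norm A * enorm x.
Proof.
have [/enorm_eq0 ->|x0] := eqVneq (enorm x) 0.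
  by rewrite mulmx0 !enorm0 mulr0.
have xp : 0 < enorm x by rewrite lt_neqAle eq_sym x0 enorm_ge0.
rewrite -ler_pdivrMr //.
apply: sup_upper_bound; first exact: has_sup_spectral_norm.
(* The supremum is tested at [x] rescaled to unit length. *)
exists ((enorm x)^-1 *: x); rewrite /= -?scalemxAr enormZ.
  by rewrite ger0_norm ?invr_ge0 ?enorm_ge0 // mulVf.
by rewrite ger0_norm ?invr_ge0 ?enorm_ge0 // mulrC.
Qed.

End SpectralNorm.
End EuclideanNorm.

(** Taking the square root of a nonnegative number moves it towards 1. *)
Lemma enorm_near1 {R : realType} {n : nat} {x : 'cV[R]_n} {eps : R} :
  eps <= 1 -> `|dot x x - 1| <= eps -> 1 - eps <= enorm x <= 1 + eps.
Proof.
move=> e1; rewrite ler_norml -sqr_enorm => /andP[lo hi].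
have := enorm_ge0 x; move: (enorm x) lo hi => a lo hi a0.
by apply/andP; split; nra.
Qed.

(** * Rounding errors within one iteration *)

Section LanczosStep.
Context {R : realType} {n : nat}.
Context {A : 'M[R]_n} {eps beta alpha : R}.
Context {vp v u w z eu ew ez Delta : 'cV[R]_n} {ea : R}.
Local Notation N := (spectral_norm A).

Hypothesis eps_bounds : 0 <= eps <= 1 / 20.
Hypothesis beta_ge0 : 0 <= beta.
(** Only an upper bound is asked of the previous vector, because it is zero in the first
    iteration. *)
Hypothesis vp_le : enorm vp <= 1 + eps.
Hypothesis v_unit : `|dot v v - 1| <= eps.
Hypothesis eu_le : enorm eu <= eps * N * enorm v.
Hypothesis uE : u = A *m v + eu.
Hypothesis ew_le : enorm ew <= eps * (enorm u + beta * enorm vp).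
Hypothesis wE : w = u - beta *: vp + ew.
Hypothesis ea_le : `|ea| <= eps * enorm v * enorm w.
Hypothesis alphaE : alpha = dot v w + ea.
Hypothesis ez_le : enorm ez <= eps * (enorm w + `|alpha| * enorm v).
Hypothesis zE : z = w - alpha *: v + ez.
Hypothesis Delta_le : enorm Delta <= eps * enorm z.

Let v_bounds : 1 - eps <= enorm v <= 1 + eps.
Proof. by apply: enorm_near1 v_unit; case/andP: eps_bounds; lra. Qed.

Let sqv_le : enorm v ^+ 2 <= 1 + eps.
Proof. by move: v_unit; rewrite sqr_enorm ler_norml; lra. Qed.

(** One factor [1 + eps] comes from rounding the product, the other from the length of [v]. *)
Lemma lanczos_u_le : enorm u <= (1 + eps) ^+ 2 * N.
Proof.
have N0 := spectral_norm_ge0 A.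
have Av := enorm_mulmx_le A v; have := enormD (A *m v) eu; rewrite -uE.
case/andP: eps_bounds => e0 _; case/andP: v_bounds => _ vhi.
have : (1 + eps) * N * enorm v <= (1 + eps) * N * (1 + eps).
  by rewrite ler_wpM2l // mulr_ge0 //; lra.
move: eu_le; lra.
Qed.

Lemma lanczos_w_le : enorm w <= (1 + eps) ^+ 3 * N + (1 + eps) ^+ 2 * beta.
Proof.
case/andP: eps_bounds => e0 _.
have H1 := enormD (u - beta *: vp) ew; rewrite -wE in H1.
have H2 := enormB u (beta *: vp); rewrite enormZ ger0_norm // in H2.
have H3 : (1 + eps) * enorm u <= (1 + eps) * ((1 + eps) ^+ 2 * N).
  by rewrite ler_wpM2l ?lanczos_u_le //; lra.
have H4 : (1 + eps) * beta * enorm vp <= (1 + eps) * beta * (1 + eps).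
  by rewrite ler_wpM2l // mulr_ge0 //; lra.
move: ew_le; lra.
Qed.

(** Here [9 / 4] is [1 + 5 / 4]: by Cauchy-Schwarz, [|alpha| * enorm v] is at most
    [(1 + eps) ^+ 2 * enorm w], and [(21 / 20) ^+ 2 <= 5 / 4]. *)
Lemma lanczos_ez_le : enorm ez <= 9 / 4 * eps * enorm w.
Proof.
case/andP: eps_bounds => e0 e1; have vv := sqv_le; have w0 := enorm_ge0 w; have v0 := enorm_ge0 v.
apply: le_trans ez_le _.
rewrite mulrAC mulrC ler_wpM2r //.
have al : `|alpha| <= (1 + eps) * (enorm v * enorm w).
  rewrite alphaE; apply: le_trans (ler_normD _ _) _.
  by have := normr_dot_le v w; move: ea_le; lra.
have H : `|alpha| * enorm v <= (1 + eps) * (enorm v * enorm w) * enorm v.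
  by rewrite ler_wpM2r.
have H2 : (1 + eps) * enorm v ^+ 2 <= (1 + eps) * (1 + eps).
  by rewrite ler_wpM2l //; lra.
have H3 : (1 + eps) * enorm v ^+ 2 * enorm w <= 5 / 4 * enorm w.
  have ee : eps * eps <= 1 / 20 * eps by rewrite ler_wpM2r //; lra.
  by rewrite ler_wpM2r //; lra.
lra.
Qed.

(** The left side is the length of [ea *: v], the form in which the error of [alpha] enters [z]. *)
Lemma lanczos_ea_le : `|ea| * enorm v <= 21 / 20 * eps * enorm w.
Proof.
case/andP: eps_bounds => e0 e1; have vv := sqv_le; have w0 := enorm_ge0 w; have v0 := enorm_ge0 v.
have H : `|ea| * enorm v <= eps * enorm v * enorm w * enorm v by rewrite ler_wpM2r.
have H2 : (eps * enorm w) * enorm v ^+ 2 <= (eps * enorm w) * (21 / 20).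
  by rewrite ler_wpM2l ?mulr_ge0 //; lra.
lra.
Qed.

(** The exact projection costs nothing and the errors cost [9 / 4 + 21 / 20 <= 4] times [eps]. A
    triangle inequality on [w - alpha *: v] would give a factor near 2, which compounds
    exponentially over the iterations. *)
Lemma lanczos_z_le : enorm z <= (1 + 4 * eps) * enorm w.
Proof.
case/andP: eps_bounds => e0 e1; have vv := sqv_le; have w0 := enorm_ge0 w.
have -> : z = (w - dot v w *: v) - ea *: v + ez.
  by rewrite zE alphaE scalerDl opprD !addrA.
have H1 := enormD ((w - dot v w *: v) - ea *: v) ez.
have H2 := enormB (w - dot v w *: v) (ea *: v); rewrite enormZ in H2.
have H3 : enorm (w - dot v w *: v) <= enorm w.
  by apply: enorm_sub_proj_le; rewrite -sqr_enorm; lra.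
have H4 := lanczos_ez_le; have H5 := lanczos_ea_le.
have : 0 <= eps * enorm w by rewrite mulr_ge0.
lra.
Qed.

Lemma lanczos_Delta_le : enorm Delta <= 6 / 5 * eps * enorm w.
Proof.
case/andP: eps_bounds => e0 e1; have vv := sqv_le; have w0 := enorm_ge0 w.
apply: le_trans Delta_le _; rewrite mulrAC mulrC ler_wpM2r //.
by apply: le_trans lanczos_z_le _; rewrite ler_wpM2r //; lra.
Qed.

Lemma lanczos_beta_le {beta' : R} {vn : 'cV[R]_n} :
  0 <= beta' -> `|dot vn vn - 1| <= eps -> beta' *: vn = z + Delta ->
  beta' <= (1 + 20 * eps) * (N + beta).
Proof.
case/andP: eps_bounds => e0 e1 b0 vn1 E.
have N0 := spectral_norm_ge0 A; have w0 := enorm_ge0 w.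
have /andP[lo _] : 1 - eps <= enorm vn <= 1 + eps by apply: enorm_near1; lra.
have H1 := enormD z Delta; rewrite -E enormZ ger0_norm // in H1.
have H2 : beta' * (1 - eps) <= beta' * enorm vn by rewrite ler_wpM2l.
have H3 : (1 + eps) * enorm z <= (1 + eps) * ((1 + 4 * eps) * enorm w).
  by rewrite ler_wpM2l ?lanczos_z_le //; lra.
(* The coefficient of [beta] is raised to that of [N], so that [N + beta] factors out. *)
have H4 : enorm w <= (1 + eps) ^+ 3 * (N + beta).
  apply: le_trans lanczos_w_le _; rewrite mulrDr lerD2l ler_wpM2r //.
  by rewrite ler_weXn2l //; lra.
have H5 : (1 + eps) * (1 + 4 * eps) * enorm w <=
          (1 + eps) * (1 + 4 * eps) * ((1 + eps) ^+ 3 * (N + beta)).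
  by rewrite ler_wpM2l // mulr_ge0 //; lra.
(* The remaining inequality is polynomial in [eps]. Factors are merged one at a time,
   [eps <= 1 / 20] absorbing the higher powers; [1 - eps] is the lower bound on the length of
   [vn]. *)
have H6 : (1 + eps) ^+ 3 <= 1 + 4 * eps by nra.
have H7 : (1 + eps) * (1 + 4 * eps) <= 1 + 21 / 4 * eps by nra.
have H8 : (1 + 21 / 4 * eps) * (1 + 4 * eps) <= 1 + 11 * eps by nra.
have H9 : 1 + 11 * eps <= (1 - eps) * (1 + 20 * eps) by nra.
have H10 : (1 + eps) * (1 + 4 * eps) * (1 + eps) ^+ 3 <=
           (1 - eps) * (1 + 20 * eps).
  apply: le_trans H9; apply: le_trans H8.
  apply: ler_pM => //; first by rewrite mulr_ge0 //; lra.
  by rewrite exprn_ge0 //; lra.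
have H11 : (1 + eps) * (1 + 4 * eps) * (1 + eps) ^+ 3 * (N + beta) <=
           (1 - eps) * (1 + 20 * eps) * (N + beta).
  by rewrite ler_wpM2r // addr_ge0.
have d0 : 0 < 1 - eps by lra.
rewrite -(ler_pM2l d0); move: Delta_le; lra.
Qed.

(** The vector [t] stands for [beta_j v_{j+1}]. Using it only through [z + Delta] also covers
    termination, where [t] is zero. *)
Lemma lanczos_residual_le {t : 'cV[R]_n} : t = z + Delta ->
  enorm (A *m v - beta *: vp - alpha *: v - t) <= 10 * eps * (N + beta).
Proof.
case/andP: eps_bounds => e0 e1 tE.
have N0 := spectral_norm_ge0 A; case/andP: v_bounds => _ vhi.
have -> : A *m v - beta *: vp - alpha *: v - t = - (eu + ew + (ez + Delta)).
  rewrite tE zE wE uE; apply/colP => i; rewrite !mxE; ring.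
rewrite enormN.
have H1 := enormD (eu + ew) (ez + Delta).
have H2 := enormD eu ew; have H3 := enormD ez Delta.
have H4 := lanczos_ez_le; have H5 := lanczos_Delta_le.
have H6 : enorm w <= 6 / 5 * (N + beta).
  apply: le_trans lanczos_w_le _; rewrite mulrDr.
  by apply: lerD; rewrite ler_wpM2r //; nra.
have H7 : enorm u <= 6 / 5 * N.
  by apply: le_trans lanczos_u_le _; rewrite ler_wpM2r //; nra.
have H8 : eps * enorm w <= eps * (6 / 5 * (N + beta)) by rewrite ler_wpM2l.
have H9 : eps * enorm u <= eps * (6 / 5 * N) by rewrite ler_wpM2l.
have H10 : eps * (beta * enorm vp) <= eps * (beta * (6 / 5)).
  by rewrite !ler_wpM2l //; move: vp_le; lra.
have H11 : eps * N * enorm v <= eps * N * (6 / 5).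
  by rewrite ler_wpM2l ?mulr_ge0 //; lra.
have eN : 0 <= eps * N by rewrite mulr_ge0.
have eb : 0 <= eps * beta by rewrite mulr_ge0.
move: eu_le ew_le; lra.
Qed.

(** Substituting [alpha] cancels [dot v w] up to the normalization defect [1 - dot v v], which is
    itself at most [eps]; every other term contains a rounding error. *)
Lemma lanczos_local_orthogonality {t : 'cV[R]_n} : t = z + Delta ->
  `|dot v t| <= 10 * eps * (N + beta).
Proof.
case/andP: eps_bounds => e0 e1 tE.
have N0 := spectral_norm_ge0 A; have w0 := enorm_ge0 w.
case/andP: v_bounds => _ vhi.
have -> : dot v t =
    dot v w * (1 - dot v v) - ea * dot v v + (dot v (ez + Delta)).
  rewrite tE zE !(dotDr, dotNr, dotZr) alphaE; ring.
have H1 := normr_dot_le v (ez + Delta); have H2 := enormD ez Delta.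
have H3 := lanczos_ez_le; have H4 := lanczos_Delta_le; have H5 := lanczos_ea_le.
have H6 : enorm w <= 6 / 5 * (N + beta).
  apply: le_trans lanczos_w_le _; rewrite mulrDr.
  by apply: lerD; rewrite ler_wpM2r //; nra.
have H7 : eps * enorm w <= eps * (6 / 5 * (N + beta)) by rewrite ler_wpM2l.
have v0 := enorm_ge0 v; have vv := sqv_le.
have H8 : `|dot v w * (1 - dot v v)| <= 21 / 20 * enorm w * eps.
  rewrite normrM distrC ler_pM //; apply: le_trans (normr_dot_le v w) _.
  by rewrite ler_wpM2r //; lra.
have H9 : `|ea * dot v v| <= 21 / 20 * (21 / 20 * eps * enorm w).
  rewrite normrM (ger0_norm (dot_ge0 v)) -sqr_enorm expr2.
  rewrite [leLHS]mulrA [leLHS]mulrC ler_pM ?mulr_ge0 //; lra.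
have H10 : enorm v * enorm (ez + Delta) <= 21 / 20 * (4 * eps * enorm w).
  have ew0 : 0 <= eps * enorm w by rewrite mulr_ge0.
  by rewrite ler_pM ?enorm_ge0 //; lra.
have H11 := ler_normD (dot v w * (1 - dot v v) - ea * dot v v) (dot v (ez + Delta)).
have H12 := ler_normB (dot v w * (1 - dot v v)) (ea * dot v v).
have H13 : 0 <= eps * enorm w by rewrite mulr_ge0.
have H14 : 0 <= eps * (N + beta) by rewrite !(mulr_ge0, addr_ge0).
lra.
Qed.

End LanczosStep.

(** * Normalization and growth of [beta] along a run *)

Section LanczosRun.
Context {R : realType} {n : nat}.
Context {A : 'M[R]_n} {v0 : 'cV[R]_n} {eps : R} {k : nat}.
Context {L : lanczos_data R n}.
Hypothesis run : lanczos_run A v0 eps k L.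
Hypothesis eps_bounds : 0 <= eps <= 1 / 20.

(** For [j = 1] this is the initialization; a later vector was normalized by the preceding
    iteration, which did not terminate. *)
Lemma lanczos_v_unit {j} : (1 <= j <= k)%N ->
  `|dot (lv L j) (lv L j) - 1| <= eps.
Proof.
case: run => -[_ _ v1 _] _ next nz; case: j => [|[|j]] // jk.
have := next j.+1 (ltnW jk); have := nz j.+1 jk.
by case: (L) => v u w z al be /= zj [/(_ zj)[]].
Qed.

Lemma lanczos_v_le {j} : (j <= k)%N -> enorm (lv L j) <= 1 + eps.
Proof.
have /andP[eps0 eps1] := eps_bounds; case: j => [_|j jk].
  by case: run => -[-> _ _ _] _ _ _; rewrite enorm0 addr_ge0.
have e1 : eps <= 1 by move: eps1; lra.
by have /andP[] := enorm_near1 e1 (lanczos_v_unit (j := j.+1) jk).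
Qed.

Lemma lanczos_beta_ge0 {j} : (j <= k)%N -> 0 <= lbeta L j.
Proof.
case: j => [_|j jk]; first by case: run => -[_ -> _ _].
case: run => _ _ /(_ j.+1 jk) + _.
case: (L) => v u w z al be /= [zn z0].
by have [/z0 ->|/zn[/ltW]] := eqVneq (z j.+1) 0.
Qed.

Lemma lanczos_next_vector {j} : (1 <= j <= k)%N ->
  exists2 Delta, enorm Delta <= eps * enorm (lz L j) &
    lbeta L j *: lv L j.+1 = lz L j + Delta.
Proof.
case: run => _ _ next _ /next.
case: (L) => v u w z al be /= [zn z0].
have [zj|/zn[_ [D ? ?] _]] := eqVneq (z j) 0; last by exists D.
(* On termination the zero error realizes the convention [Delta_k = 0]. *)
by exists 0; rewrite zj ?enorm0 ?mulr0 // (z0 zj) scale0r addr0.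
Qed.

(* Restricted to [j < k]: if the run terminates, [lv L k.+1] is junk. *)
Lemma lanczos_beta_rec {j} : (1 <= j < k)%N ->
  lbeta L j <= (1 + 20 * eps) * (spectral_norm A + lbeta L j.-1).
Proof.
case/andP=> j1 jk.
have jk1 : (1 <= j <= k)%N by rewrite j1 ltnW.
have jp : (j.-1 <= k)%N by rewrite (leq_trans (leq_pred j)) // ltnW.
have [D D_le DE] := lanczos_next_vector jk1.
have := lanczos_v_unit jk1; have := lanczos_v_unit (j := j.+1) jk.
have := lanczos_beta_ge0 jp; have := lanczos_beta_ge0 (ltnW jk).
have := lanczos_v_le jp.
case: run => _ /(_ j jk1) + _ _; move: D_le DE.
case: (L) => v u w z al be /= D_le DE.
case=> -[eu eu_le uE] [ew ew_le wE] [ea ea_le alE] [ez ez_le zE] vp_le b' b vn1 v1.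
exact: (lanczos_beta_le eps_bounds b vp_le v1 eu_le uE ew_le wE
          ea_le alE ez_le zE D_le b' vn1 DE).
Qed.

(** With [q = 1 + 20 * eps], each iteration multiplies by [q] and adds one more norm of [A]; as
    [q >= 1], that new term may also carry the power [q ^+ j]. *)
Lemma lanczos_beta_pow_le {j} : (j < k)%N ->
  lbeta L j <= (1 + 20 * eps) ^+ j * (j%:R * spectral_norm A).
Proof.
have N0 := spectral_norm_ge0 A.
elim: j => [_|j IH jk].
  by case: run => -[_ -> _ _] _ _ _; rewrite mul0r mulr0.
apply: le_trans (lanczos_beta_rec (j := j.+1) jk) _ => /=.
have x1 : 1 <= 1 + 20 * eps by case/andP: eps_bounds; lra.
rewrite exprS -mulrA ler_wpM2l ?(le_trans ler01) //.
rewrite -(natr1 j) (mulrDl _ 1) mul1r mulrDr [leRHS]addrC.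
by rewrite lerD ?IH ?(ltnW jk) // ler_peMl // exprn_ege1.
Qed.

Lemma lanczos_beta_linear {j} : 20 * eps * k%:R <= 1 -> (j < k)%N ->
  lbeta L j <= expR 1 * (j%:R * spectral_norm A).
Proof.
move=> ek jk; apply: le_trans (lanczos_beta_pow_le jk) _.
have /andP[e0 _] := eps_bounds.
rewrite ler_wpM2r ?mulr_ge0 ?spectral_norm_ge0 //.
(* From [1 + x <= exp x], the power is at most [exp (20 * eps * j)], whose exponent is at most 1. *)
apply: (@le_trans _ _ (expR (20 * eps) ^+ j)).
  by rewrite lerXn2r ?nnegrE ?expR_ge0 ?expR_ge1Dx // addr_ge0 ?mulr_ge0.
rewrite -expRM_natl ler_expR; apply: le_trans ek.
by rewrite mulrC ler_wpM2l ?mulr_ge0 // ler_nat ltnW.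
Qed.

End LanczosRun.

Theorem theorem3p1 (R : realType) :
  exists c d : R, 0 < c /\ 0 < d /\
  forall (n kmax k : nat) (A : 'M[R]_n) (v : 'cV[R]_n) (eps : R)
    (L : lanczos_data R n),
  (1 <= n)%N -> (1 <= kmax)%N -> (1 <= k <= kmax)%N ->
  A^T = A -> v != 0 ->
  0 <= eps <= 1 / (20 * kmax%:R) ->
  lanczos_run A v eps k L ->
  let f := fun j : nat => A *m lv L j - lbeta L j.-1 *: lv L j.-1
                  - lalpha L j *: lv L j - lbeta L j *: lv L j.+1 in
  let g := fun j : nat => dot (lv L j) (lv L j) - 1 in
  let p := fun j : nat => dot (lv L j) (lbeta L j *: lv L j.+1) in
  forall j : nat, (1 <= j <= k)%N ->
    [/\ enorm (f j) <= c * (k%:R `^ d) * eps * spectral_norm A,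
        `|g j| <= eps &
        `|p j| <= c * (k%:R `^ d) * eps * spectral_norm A].
Proof.
(* The 10 comes from the one-iteration bounds, [expR 1] from the growth of [beta], and the exponent
   1 from its linear dependence on [k]. *)
exists (10 * expR 1), 1; split; first by rewrite mulr_gt0 ?expR_gt0.
split=> // n kmax k A v eps L _ kmax1 /andP[k1 kkmax] _ _ /andP[e0 e_le] run f g p j jk.
have ekmax : 20 * eps * kmax%:R <= 1.
  by move: e_le; rewrite ler_pdivlMr ?mulr_gt0 ?ltr0n //; lra.
have ek : 20 * eps * k%:R <= 1.
  by apply: le_trans ekmax; rewrite ler_wpM2l ?mulr_ge0 ?ler_nat.
have eps_bounds : 0 <= eps <= 1 / 20.
  have : 20 * eps * 1 <= 20 * eps * k%:R by rewrite ler_wpM2l ?mulr_ge0 ?ler1n.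
  lra.
have N0 := spectral_norm_ge0 A.
case/andP: (jk) => j1 jk'.
(* Iteration [j] involves [beta] at [j.-1], strictly below [k], so the growth bound applies even for
   [j = k]. *)
have jpk : (j.-1 < k)%N by rewrite prednK.
have b_le : spectral_norm A + lbeta L j.-1 <= expR 1 * k%:R * spectral_norm A.
  have e1 : 1 <= expR 1 :> R by rewrite -[X in X <= _]expR0 ler_expR.
  have H1 := lanczos_beta_linear run eps_bounds ek jpk.
  have H2 : 1 * spectral_norm A <= expR 1 * spectral_norm A by rewrite ler_wpM2r.
  (* The extra norm of [A] raises the count from [j.-1] to [j], still at most [k]. *)
  have H3 : expR 1 * (j.-1.+1%:R * spectral_norm A) <=
            expR 1 * (k%:R * spectral_norm A).
    by rewrite ler_wpM2l ?expR_ge0 // ler_wpM2r // ler_nat.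
  by rewrite -(natr1 j.-1) in H3; lra.
rewrite powRr1 //.
have bound : 10 * eps * (spectral_norm A + lbeta L j.-1) <=
             10 * expR 1 * k%:R * eps * spectral_norm A.
  have : 10 * eps * (spectral_norm A + lbeta L j.-1) <=
         10 * eps * (expR 1 * k%:R * spectral_norm A).
    by rewrite ler_wpM2l ?mulr_ge0.
  lra.
have [D D_le DE] := lanczos_next_vector run jk.
have v1 := lanczos_v_unit run jk; have b := lanczos_beta_ge0 run (ltnW jpk).
have vp_le := lanczos_v_le run eps_bounds (ltnW jpk).
suff [f_le p_le] : enorm (f j) <= 10 * eps * (spectral_norm A + lbeta L j.-1) /\
    `|p j| <= 10 * eps * (spectral_norm A + lbeta L j.-1).
  by split=> //; apply: le_trans bound.
case: run => _ /(_ j jk) + _ _; rewrite {}/f {}/p {g bound b_le}.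
move: D_le DE v1 b vp_le; case: L => vv u w z al be /= D_le DE v1 b vp_le.
case=> -[eu eu_le uE] [ew ew_le wE] [ea ea_le alE] [ez ez_le zE]; split.
- exact: (lanczos_residual_le eps_bounds b vp_le v1 eu_le uE ew_le wE
          ea_le alE ez_le zE D_le DE).
- exact: (lanczos_local_orthogonality eps_bounds b vp_le v1 eu_le uE ew_le wE
          ea_le alE ez_le zE D_le DE).
Qed.
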